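(* Let $X$ be the Fermat quintic threefold, $L$ its real points, $g\in G$ and $\gamma=e^{2\pi i/5}$. Suppose $u:\mathbb{CP}^1=\mathbb C\cup\{\infty\}\to X$ is a holomorphic sphere satisfying (1) $u(z)=\overline{u(\bar z)}$, and (2) $u(\gamma z)=g^2u(z)$. Then there exists a holomorphic strip $u_0:S_0\to X$, mapping the ray $\mathbb R_{\ge0}$ into $L$ and the ray $e^{2\pi i/10}\mathbb R_{\ge0}$ into $gL$, from which $u$ is obtained by reflection.
   Context: $X=\{X_0^5+\cdots+X_4^5=0\}\subset\mathbb{CP}^4$; the bar on points of $X$ is complex conjugation of homogeneous coordinates; $L=\{[X_0:\dots:X_4]\in X:X_i\in\mathbb R\}$; $G$ is the group of automorphisms of $X$ multiplying homogeneous coordinates by fifth roots of unity. Let $\sigma=e^{2\pi i/10}$ and $S_0\subset\mathbb C$ be the sector bounded by the rays $\mathbb R_{\ge0}$ and $\sigma\mathbb R_{\ge0}$ (vertex removed), biholomorphic to the strip $\mathbb R\times[0,1]$ via $z\mapsto e^{\pi z/5}$. Reflection: given a finite-energy holomorphic $u_0:S_0\to X$ mapping $\mathbb R_{\ge0}$ into $L$ and $\sigma\mathbb R_{\ge0}$ into $gL$, put $S_k=\sigma^kS_0$ and for $1\le k\le9$ define $u_k:S_k\to X$ by $u_k(z)=g^{k+1}\overline{u_0(\sigma^{k+1}\bar z)}$ for $k$ odd and $u_k(z)=g^ku_0(\sigma^{-k}z)$ for $k$ even. The maps $u_0,\dots,u_9$ glue to a holomorphic map $\mathbb C\setminus\{0\}\to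 X$ which extends to a holomorphic map $\mathbb{CP}^1\to X$; this is the sphere obtained from $u_0$ by reflection. *)

(* Defs.v *)
From HB Require Import structures.
From mathcomp Require Import all_boot all_order all_algebra.
From mathcomp Require Import complex.
From mathcomp Require Import all_classical all_reals all_analysis.
Set Implicit Arguments. Unset Strict Implicit. Unset Printing Implicit Defensive.
Import Order.TTheory GRing.Theory Num.Theory numFieldNormedType.Exports.
Local Open Scope classical_set_scope.
Local Open Scope ring_scope.
Local Open Scope complex_scope.

(* CP^n as the set of complex lines through 0 in C^(n+1). *)
Definition projective_space (R : rcfType) (n : nat) :=
  {V : {vspace 'rV[R[i]]_n.+1} | \dim V == 1%N}.

(* [homog p v]: p = [v_0 : ... : v_n]; then v != 0, because p has dimension 1. *)
Definition homog (R : rcfType) (n : nat) (p : projective_space R n)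
  (v : 'rV[R[i]]_n.+1) : Prop := val p = <[v]>%VS.

(* A choice of homogeneous coordinates. *)
Definition hcoord (R : rcfType) (n : nat) (p : projective_space R n)
  : 'rV[R[i]]_n.+1 := vpick (val p).

Lemma hcoord_neq0 (R : rcfType) (n : nat) (p : projective_space R n) :
  hcoord p != 0.
Proof. by rewrite vpick0; case: p => V /= /eqP dV; apply/eqP => V0; rewrite V0 dimv0 in dV. Qed.

Lemma hcoordP (R : rcfType) (n : nat) (p : projective_space R n) :
  homog p (hcoord p).
Proof.
rewrite /homog; apply/eqP; rewrite eq_sym eqEdim -memvE memv_pick /=.
by rewrite dim_vline hcoord_neq0 (eqP (valP p)).
Qed.

Lemma homogZ (R : rcfType) (n : nat) (p : projective_space R n) v w :
  homog p v -> homog p w -> exists2 c : R[i], c != 0 & w = c *: v.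
Proof.
move=> pv pw; have : w \in val p by rewrite pw memv_line.
rewrite pv => /vlineP[c wE]; exists c => //; apply/eqP => c0.
by move: (eqP (valP p)); rewrite pw wE c0 scale0r dim_vline eqxx.
Qed.

Definition fermat_eq (R : rcfType) (v : 'rV[R[i]]_5) : bool :=
  \sum_(i < 5) v 0 i ^+ 5 == 0.

Definition quintic (R : rcfType) :=
  {p : projective_space R 4 | fermat_eq (hcoord p)}.

Lemma fermat_eqE (R : rcfType) (p : projective_space R 4) v :
  homog p v -> fermat_eq (hcoord p) = fermat_eq v.
Proof.
move=> pv; have [c c0 ->] := homogZ pv (hcoordP p).
rewrite /fermat_eq; under eq_bigr do rewrite mxE exprMn.
by rewrite -mulr_sumr mulf_eq0 expf_eq0 /= (negPf c0).
Qed.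

Lemma conj_line_subproof (R : rcfType) (n : nat) (p : projective_space R n) :
  \dim <[map_mx (@conjc R) (hcoord p)]>%VS == 1%N.
Proof. by rewrite dim_vline map_mx_eq0 hcoord_neq0. Qed.

Definition conj_proj (R : rcfType) (n : nat) (p : projective_space R n)
  : projective_space R n :=
  exist (fun V => \dim V == 1%N) _ (conj_line_subproof p).

Lemma conj_projP (R : rcfType) (n : nat) (p : projective_space R n) v :
  homog p v -> homog (conj_proj p) (map_mx (@conjc R) v).
Proof.
move=> pv; have [c c0 wE] := homogZ pv (hcoordP p).
rewrite /homog /= wE map_mxZ; apply/eqP; rewrite eqEdim -memvE memvZ ?memv_line//=.
rewrite !dim_vline scaler_eq0 conjc_eq0 (negPf c0) /=.
by case: (_ == 0).
Qed.

Lemma conj_quintic_subproof (R : rcfType) (p : quintic R) :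
  fermat_eq (hcoord (conj_proj (val p))).
Proof.
rewrite (fermat_eqE (conj_projP (hcoordP _))) /fermat_eq.
under eq_bigr do rewrite mxE -rmorphXn.
by rewrite -rmorph_sum /= conjc_eq0; exact: valP p.
Qed.

Definition conj_quintic (R : rcfType) (p : quintic R) : quintic R :=
  exist (fun q => fermat_eq (hcoord q)) _ (conj_quintic_subproof p).

Definition real_locus (R : rcfType) : set (quintic R) :=
  [set p | exists2 v, homog (val p) v & forall i, complex.Im (v 0 i) = 0].
Arguments real_locus : clear implicits.

Definition root5_automorphisms (R : rcfType) : set (quintic R -> quintic R) :=
  [set g | exists2 a : 'I_5 -> R[i], (forall i, a i ^+ 5 = 1) &
    forall p v, homog (val p) v ->
      homog (val (g p)) (\row_i (a i * v 0 i))].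
Arguments root5_automorphisms : clear implicits.

(* X_j / X_i: for fixed i these are the affine coordinates on {X_i != 0}. *)
Definition affine (R : rcfType) (i j : 'I_5) (p : quintic R) : R[i] :=
  hcoord (val p) 0 j / hcoord (val p) 0 i.

Definition in_chart (R : rcfType) (i : 'I_5) (p : quintic R) : bool :=
  hcoord (val p) 0 i != 0.

(* A function of one complex variable is holomorphic when it is a C^1 solution
   of the Cauchy-Riemann equation, that is, complex differentiable with
   continuous derivative. *)
Definition holomorphic_fun_at (R : realType) (F : R[i]^o -> R[i]^o)
    (z : R[i]^o) : Prop :=
  \forall w \near z, derivable F w 1 /\ {for w, continuous (derive1 F)}.

(* Holomorphy in a neighbourhood of z, in every affine chart containing f z.
   The first conjunct, with the second, makes f continuous at z. *)
Definition holomorphic_at (R : realType) (f : R[i] -> quintic R)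
    (z : R[i]) : Prop :=
  forall i, in_chart i (f z) ->
    (\forall w \near (z : R[i]^o), in_chart i (f w)) /\
    (forall j, holomorphic_fun_at (fun w : R[i]^o => affine i j (f w)) z).

(* CP^1 is [option R[i]], with [None] the point at infinity, and with the chart
   w |-> 1/w at infinity. *)
Definition inv_chart (R : realType) (w : R[i]) : option R[i] :=
  if w == 0 then None else Some w^-1.

Definition holomorphic_sphere (R : realType) (u : option R[i] -> quintic R)
    : Prop :=
  (forall z, holomorphic_at (fun w => u (Some w)) z) /\
  holomorphic_at (fun w => u (inv_chart w)) 0.

(* As usual, for A not open: f extends holomorphically near every point of A,
   boundary points included. *)
Definition holomorphic_on (R : realType) (A : set R[i]) (f : R[i] -> quintic R)
    : Prop :=
  forall z, A z -> exists2 h : R[i] -> quintic R, holomorphic_at h z &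
    \forall w \near (z : R[i]^o), A w -> f w = h w.

Definition expi (R : realType) (t : R) : R[i] := cos t +i* sin t.

Definition sigma (R : realType) : R[i] := expi (2 * pi / 10).

Definition gamma (R : realType) : R[i] := expi (2 * pi / 5).

Definition sector0 (R : realType) : set R[i] :=
  [set z | exists r t : R, [/\ 0 < r, 0 <= t, t <= 2 * pi / 10 &
                             z = r%:C * expi t]].
Arguments sector0 : clear implicits.

Definition open_sector0 (R : realType) : set R[i] :=
  [set z | exists r t : R, [/\ 0 < r, 0 < t, t < 2 * pi / 10 &
                             z = r%:C * expi t]].
Arguments open_sector0 : clear implicits.

Definition sector (R : realType) (k : nat) : set R[i] :=
  [set sigma R ^+ k * z | z in sector0 R].
Arguments sector : clear implicits.

Definition sqmod (R : realType) (z : R[i]) : R :=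
  complex.Re z ^+ 2 + complex.Im z ^+ 2.

(* The density, with respect to dx dy, of the pull-back by f of the
   Fubini-Study form i/2 ddbar log |X|^2, computed in an affine chart w around
   f z: (|w|^2 |w'|^2 - |<w', w>|^2) / |w|^4.  It does not depend on the chart. *)
Definition energy_density (R : realType) (f : R[i] -> quintic R) (z : R[i]) : R :=
  let i := odflt ord0 [pick i | in_chart i (f z)] in
  let w j := affine i j (f z) in
  let dw j := derive1 (fun x : R[i]^o => affine i j (f x) : R[i]^o) z in
  let N := \sum_j sqmod (w j) in
  (N * (\sum_j sqmod (dw j)) - sqmod (\sum_j dw j * conjc (w j))) / N ^+ 2.

(* The energy is conformally invariant, so it may be computed on the sector
   rather than on the strip; the boundary rays, where f need not be
   differentiable as a map on C, are negligible. *)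
Definition energy (R : realType) (f : R[i] -> quintic R) : \bar R :=
  (\int[(@lebesgue_measure R \x @lebesgue_measure R)%E]_(p in
      [set p : R * R | open_sector0 R (p.1 +i* p.2)])
    (energy_density f (p.1 +i* p.2))%:E)%E.

(* u0 is a total function of which only the values on the sector matter. *)
Definition holomorphic_strip (R : realType) (g : quintic R -> quintic R)
    (u0 : R[i] -> quintic R) : Prop :=
  [/\ holomorphic_on (sector0 R) u0,
      (energy u0 < +oo)%E,
      forall r : R, 0 < r -> real_locus R (u0 r%:C) &
      forall r : R, 0 < r -> (g @` real_locus R) (u0 (sigma R * r%:C))].

(* The map u_k on the k-th sector; it is u0 for k = 0. *)
Definition reflected (R : realType) (g : quintic R -> quintic R)
    (u0 : R[i] -> quintic R) (k : nat) (z : R[i]) : quintic R :=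
  if odd k then iter k.+1 g (conj_quintic (u0 (sigma R ^+ k.+1 * conjc z)))
  else iter k g (u0 (sigma R ^- k * z)).

(* u is the holomorphic extension to CP^1 of the map glued from the u_k. *)
Definition obtained_by_reflection (R : realType) (g : quintic R -> quintic R)
    (u0 : R[i] -> quintic R) (u : option R[i] -> quintic R) : Prop :=
  holomorphic_sphere u /\
  forall k, (k < 10)%N -> forall z, sector R k z ->
    u (Some z) = reflected g u0 k z.

(* Main.v *)
(* By the two symmetries of u, the rotation z |-> sigma^2 z acts on u as g^2 and
   conjugation of z acts as conjugation on X, so u is the reflection of its own
   restriction u0 to the sector.  On the ray sigma R_+ one gets
   u = g^2 (conj u), that is, g^-1 u is fixed by conjugation.  The energy is
   finite because the energy density of a holomorphic sphere is O(|z|^-4) at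
   infinity. *)
Require Import Defs.
From mathcomp Require Import all_boot all_order all_algebra complex.
From mathcomp Require Import all_classical all_reals all_analysis.
From mathcomp Require Import measurable_realfun ring lra.
Set Implicit Arguments. Unset Strict Implicit. Unset Printing Implicit Defensive.
Import Order.TTheory GRing.Theory Num.Theory numFieldNormedType.Exports.
Local Open Scope classical_set_scope.
Local Open Scope ring_scope.
Local Open Scope complex_scope.

(** * Root-of-unity automorphisms and conjugation on the quintic *)

Lemma conjcM (R : rcfType) (z w : R[i]) : conjc (z * w) = conjc z * conjc w.
Proof. exact: rmorphM. Qed.

Lemma quintic_homog_inj (R : rcfType) (p q : quintic R) v :
  homog (val p) v -> homog (val q) v -> p = q.
Proof. by move=> pv qv; do 2 apply: val_inj; rewrite /= pv qv. Qed.

Lemma root5_iter5 (R : rcfType) (g : quintic R -> quintic R) :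
  root5_automorphisms R g -> forall p, iter 5 g p = p.
Proof.
move=> [a a5 gP] p.
have := hcoordP (val p); set v := hcoord _ => pv.
apply: (@quintic_homog_inj _ _ _ v) => //=.
have := gP _ _ (gP _ _ (gP _ _ (gP _ _ (gP _ _ pv)))).
congr homog; apply/rowP => i; rewrite !mxE.
by rewrite -[RHS]mul1r -(a5 i); ring.
Qed.

(** Fifth roots of unity have modulus 1, so conjugation inverts the scalars [a i] and hence carries
    [g] to its inverse. *)
Lemma root5_conj (R : rcfType) (g : quintic R -> quintic R) :
  root5_automorphisms R g ->
  forall p, g (conj_quintic (g p)) = conj_quintic p.
Proof.
move=> [a a5 gP] p.
have := hcoordP (val p); set v := hcoord _ => pv.
apply: (@quintic_homog_inj _ _ _ (map_mx (@conjc R) v)); last exact: conj_projP.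
have := gP (conj_quintic (g p)) _ (conj_projP (gP _ _ pv)).
congr homog; apply/rowP => i; rewrite !mxE rmorphM mulrA -sqr_normc.
suff -> : `|a i| = 1 by rewrite expr1n mul1r.
by apply/eqP; rewrite -(@pexpr_eq1 _ `|a i| 5)// -normrX a5 normr1.
Qed.

Lemma exists_chart (R : rcfType) (p : quintic R) : exists i, in_chart i p.
Proof.
have := hcoord_neq0 (val p); rewrite /in_chart => v0.
apply/existsP; apply: contraNT v0; rewrite negb_exists => /forallP v0.
by apply/eqP/rowP => i; rewrite mxE; apply/eqP; move: (v0 i); rewrite negbK.
Qed.

(** Conjugation rescales a coordinate vector by some [c]; dividing by a nonzero coordinate cancels
    [c], so the ratios are real. *)
Lemma conj_fixed_real_locus (R : rcfType) (p : quintic R) :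
  p = conj_quintic p -> real_locus R p.
Proof.
move=> pE; have [i vi0] := exists_chart p.
have := hcoord_neq0 (val p); have := hcoordP (val p).
move: vi0; rewrite /in_chart; set v := hcoord _ => vi0 pv v0.
have [c c0 vc] : exists2 c : R[i], c != 0 & map_mx (@conjc R) v = c *: v.
  by apply: (homogZ pv); rewrite {1}pE; exact: conj_projP.
have conjv j : conjc (v 0 j) = c * v 0 j.
  by have /rowP/(_ j) := vc; rewrite !mxE.
exists ((v 0 i)^-1 *: v).
  rewrite /homog pv; apply/eqP.
  rewrite eq_sym eqEdim -memvE memvZ ?memv_line//=.
  by rewrite !dim_vline scaler_eq0 invr_eq0 (negPf vi0) v0.
move=> j; rewrite mxE.
have : conjc ((v 0 i)^-1 * v 0 j) = (v 0 i)^-1 * v 0 j.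
  by rewrite rmorphM /= conjc_inv !conjv invfM mulrACA mulVf// mul1r.
case: (_ * _) => x y /= [] /eqP; rewrite eq_sym -addr_eq0 -mulr2n mulrn_eq0 /=.
by move/eqP.
Qed.

(** * Points of the unit circle and the tenth root of unity [sigma] *)

Lemma expiD (R : realType) (s t : R) : expi (s + t) = expi s * expi t.
Proof. by rewrite /expi cosD sinD; simpc; congr (_ +i* _); ring. Qed.

Lemma conj_expi (R : realType) (t : R) : conjc (expi t) = expi (- t).
Proof. by rewrite /expi cosN sinN. Qed.

Lemma expi0 (R : realType) : expi (0 : R) = 1.
Proof. by rewrite /expi cos0 sin0. Qed.

Lemma expi_neq0 (R : realType) (t : R) : expi t != 0.
Proof.
apply/eqP => e0; have := expiD t (- t); rewrite subrr expi0 e0 mul0r => /eqP.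
by rewrite oner_eq0.
Qed.

Lemma gammaE (R : realType) : gamma R = sigma R ^+ 2.
Proof. by rewrite expr2 /sigma -expiD; congr expi; field. Qed.

Lemma sigma_neq0 (R : realType) : sigma R != 0.
Proof. exact: expi_neq0. Qed.

Lemma conj_sigma (R : realType) : conjc (sigma R) = (sigma R)^-1.
Proof.
apply: (mulfI (sigma_neq0 R)); rewrite divff ?sigma_neq0//.
by rewrite /sigma conj_expi -expiD subrr expi0.
Qed.

Lemma conj_sigmaX (R : realType) k : conjc (sigma R ^+ k) = sigma R ^- k.
Proof. by rewrite -exprVn -conj_sigma rmorphXn. Qed.

(** * Consequences of the two symmetries of the sphere *)

Section Reflection.
Variables (R : realType) (g : quintic R -> quintic R).
Hypothesis hg : root5_automorphisms R g.
Variable u : option R[i] -> quintic R.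
Hypothesis hconj : forall z, u z = conj_quintic (u (omap (@conjc R) z)).
Hypothesis hrot : forall z, u (omap (fun w => gamma R * w) z) = iter 2 g (u z).

Let u0 z := u (Some z).

Lemma sphere_sigma_even k z : u0 (sigma R ^+ k.*2 * z) = iter k.*2 g (u0 z).
Proof.
elim: k z => [|k IH] z; first by rewrite expr0 mul1r.
rewrite doubleS 2!iterS -IH -[RHS]/(iter 2 g (u (Some _))) -hrot /=.
by rewrite /u0 gammaE mulrA -exprD.
Qed.

Lemma sphere_real (r : R) : real_locus R (u0 r%:C).
Proof.
by apply: conj_fixed_real_locus; rewrite /u0 [LHS]hconj /= oppr0.
Qed.

Lemma conj_sphere z : conj_quintic (u0 z) = u0 (conjc z).
Proof. by rewrite /u0 [RHS]hconj /= conjcK. Qed.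

Lemma sphere_sigma_ray (r : R) : (g @` real_locus R) (u0 (sigma R * r%:C)).
Proof.
have g5 p : g (g (g (g (g p)))) = p := root5_iter5 hg p.
(* Since g^5 = 1, [iter 4 g] is the inverse of [g]. *)
exists (iter 4 g (u0 (sigma R * r%:C))); last exact: g5.
apply: conj_fixed_real_locus; set q := u0 _.
(* Points z of this ray satisfy z = sigma^2 * conj z. *)
have qE : q = g (g (conj_quintic q)).
  rewrite conj_sphere /q -[RHS](sphere_sigma_even 1); congr u0.
  rewrite conjcM conj_sigma conjc_real expr2 -!mulrA.
  by rewrite mulVKf ?sigma_neq0.
have g_inj : injective g by exact: (@can_inj _ _ _ (iter 4 g) g5).
(* The left side becomes g^8 q = g^10 (conj q) = conj q; on the right, the four outer copies of [g]
   cancel those under the conjugation. *)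
do 4 apply/g_inj.
by rewrite /= !(root5_conj hg) {1}qE !g5.
Qed.

(** Both branches of [reflected] involve only even powers of [sigma] and [g], which the rotational
    symmetry plays off against each other; for odd [k] the conjugation symmetry first inverts the
    power of [sigma]. *)
Lemma sphere_reflected k z : u0 z = reflected g u0 k z.
Proof.
rewrite /reflected; case: ifP => [ok|/negbT ek].
  have -> : k.+1 = (uphalf k.+1).*2.
    by rewrite -[LHS]odd_double_half/= ok uphalf_half /= ok addSn add0n.
  rewrite conj_sphere conjcM conjcK conj_sigmaX -sphere_sigma_even.
  by rewrite mulVKf// expf_neq0// sigma_neq0.
have -> : k = k./2.*2 by rewrite -[LHS]odd_double_half (negPf ek).
by rewrite -sphere_sigma_even mulVKf// expf_neq0// sigma_neq0.
Qed.
End Reflection.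

(** * Algebra of the Fubini-Study density *)

(** The Gram determinant of [w] and [dw] over |w|^4: the formula of [energy_density] for arbitrary
    vectors. *)
Definition gram_quotient (R : realType) (w dw : 'I_5 -> R[i]) : R :=
  let N := \sum_j sqmod (w j) in
  (N * (\sum_j sqmod (dw j)) - sqmod (\sum_j dw j * conjc (w j))) / N ^+ 2.

Lemma sqmodE (R : realType) (z : R[i]) : (sqmod z)%:C = z * conjc z.
Proof. by rewrite /sqmod add_Re2_Im2 sqr_normc. Qed.

Lemma sqmod_ge0 (R : realType) (z : R[i]) : 0 <= sqmod z.
Proof. by rewrite addr_ge0// sqr_ge0. Qed.

Lemma sqmodM (R : realType) (z w : R[i]) : sqmod (z * w) = sqmod z * sqmod w.
Proof. by apply: complexI; rewrite sqmodE conjcM mulrACA -!sqmodE -rmorphM. Qed.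

Lemma sqmodV (R : realType) (z : R[i]) : sqmod z^-1 = (sqmod z)^-1.
Proof. by apply: complexI; rewrite sqmodE conjc_inv -invfM -sqmodE fmorphV. Qed.

(* On the overlap of two affine charts the coordinates differ by a scalar factor
   c, so their derivatives are related by [c * dw + m * w], with m = c'. *)
Lemma gram_quotient_scale (R : realType) (c m : R[i]) (w dw : 'I_5 -> R[i]) :
  c != 0 ->
  gram_quotient (fun j => c * w j) (fun j => c * dw j + m * w j) =
  gram_quotient w dw.
Proof.
move=> c0; rewrite /gram_quotient.
set N := \sum_j sqmod (w j); set T := \sum_j sqmod (dw j).
pose P := \sum_j dw j * conjc (w j).
have cN : \sum_j sqmod (c * w j) = sqmod c * N.
  by rewrite mulr_sumr; apply: eq_bigr => j _; rewrite sqmodM.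
have PJ : conjc P = \sum_j w j * conjc (dw j).
  rewrite /P rmorph_sum; apply: eq_bigr => j _.
  by rewrite rmorphM /= conjcK mulrC.
have cP : \sum_j (c * dw j + m * w j) * conjc (c * w j) =
    c * conjc c * P + conjc c * m * N%:C.
  rewrite [N%:C]rmorph_sum !mulr_sumr -big_split; apply: eq_bigr => j _ /=.
  by rewrite sqmodE conjcM; ring.
have cT : (\sum_j sqmod (c * dw j + m * w j))%:C =
    c * conjc c * T%:C + c * conjc m * P + conjc c * m * conjc P +
    m * conjc m * N%:C.
  rewrite PJ ![_%:C]rmorph_sum !mulr_sumr -!big_split; apply: eq_bigr => j _ /=.
  by rewrite !sqmodE rmorphD /= !conjcM; ring.
rewrite cN cP -/P exprMn.
(* The multiple of [w] drops out of the Gram determinant; the remaining factor |c|^4 cancels with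
   the denominator. *)
suff -> : sqmod c * N * (\sum_j sqmod (c * dw j + m * w j)) -
    sqmod (c * conjc c * P + conjc c * m * N%:C) =
    sqmod c ^+ 2 * (N * T - sqmod P).
  rewrite -mulf_div divff ?mul1r// expf_neq0//.
  apply: contraNneq c0 => sc; have := sqmodE c; rewrite sc => /esym/eqP.
  by rewrite mulf_eq0 conjc_eq0 orbb.
(* In [R[i]] each [sqmod] is a product with a conjugate, so the claim is a polynomial identity. *)
apply: complexI.
have CM (a b : R) : (a * b)%:C = a%:C * b%:C by exact: rmorphM.
have CB (a b : R) : (a - b)%:C = a%:C - b%:C by exact: rmorphB.
have JD (a b : R[i]) : conjc (a + b) = conjc a + conjc b by exact: rmorphD.
rewrite expr2 !(CM, CB) cT !(sqmodE, JD, conjcM, conjcK, conjc_real).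
ring.
Qed.

(** Serves for a change of variable in the source, where the chain rule multiplies every derivative
    by the same [c]. *)
Lemma gram_quotient_scaler (R : realType) (c : R[i]) (w dw : 'I_5 -> R[i]) :
  gram_quotient w (fun j => c * dw j) = sqmod c * gram_quotient w dw.
Proof.
rewrite /gram_quotient mulrA; congr (_ / _).
have -> : \sum_j c * dw j * conjc (w j) = c * \sum_j dw j * conjc (w j).
  by rewrite mulr_sumr; apply: eq_bigr => j _; rewrite mulrA.
have -> : \sum_j sqmod (c * dw j) = sqmod c * \sum_j sqmod (dw j).
  by rewrite mulr_sumr; apply: eq_bigr => j _; rewrite sqmodM.
by rewrite sqmodM; ring.
Qed.

(** The coordinate equal to 1 gives N >= 1, and discarding the subtracted square leaves T / N <=
    T. *)
Lemma gram_quotient_le (R : realType) (w dw : 'I_5 -> R[i]) i : w i = 1 ->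
  gram_quotient w dw <= \sum_j sqmod (dw j).
Proof.
move=> wi; rewrite /gram_quotient.
set N := \sum_j sqmod (w j); set T := \sum_j sqmod (dw j).
have T0 : 0 <= T by apply: sumr_ge0 => j _; exact: sqmod_ge0.
have N1 : 1 <= N.
  rewrite /N (bigD1 i)//= wi /sqmod /= expr1n expr0n addr0 lerDl.
  by apply: sumr_ge0 => j _; exact: sqmod_ge0.
have N0 : 0 < N by exact: lt_le_trans ltr01 N1.
rewrite ler_pdivrMr ?exprn_gt0//.
apply: (@le_trans _ _ (N * T)); first by rewrite gerBl sqmod_ge0.
by rewrite mulrC ler_wpM2l// expr2 ler_peMl// ltW.
Qed.

(** * Calculus in one variable: quotients and inversion *)

Section Derive1Field.
Variable K : numFieldType.
Implicit Types (f h : K^o -> K^o) (x : K^o).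

Lemma near_eq_derive1 f h x :
  (\forall y \near x, f y = h y) -> derive1 f x = derive1 h x.
Proof. by move=> fh; rewrite !derive1E; exact: near_eq_derive. Qed.

Lemma near_eq_derivable1 f h x :
  (\forall y \near x, f y = h y) -> derivable f x 1 -> derivable h x 1.
Proof. by move=> fh; exact: near_eq_derivable. Qed.

(** The quotient rule, arranged in the shape [c * dw + m * w] of [gram_quotient_scale]. *)
Lemma derive1_quotient f h x : derivable f x 1 -> derivable h x 1 -> h x != 0 ->
  derive1 (fun y => f y / h y) x =
  (h x)^-1 * derive1 f x + (- (h x) ^- 2 * derive1 h x) * f x.
Proof.
move=> df dh h0; rewrite !derive1E.
rewrite (@deriveM _ _ f (fun y => (h y)^-1)) //; last exact: derivableV.
by rewrite deriveV// addrC [X in _ + X = _]mulrC.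
Qed.

Lemma is_derive1_inv x : x != 0 ->
  is_derive x 1 (fun y : K^o => y^-1 : K^o) (- x ^- 2).
Proof.
move=> x0; apply: DeriveDef; first exact: (@derivableV _ _ id).
by rewrite (@deriveV _ _ id)// derive_id [LHS]mulr1.
Qed.

Lemma derivable_comp_inv f x : x != 0 -> derivable f x^-1 1 ->
  derivable (fun y : K^o => f y^-1) x 1.
Proof.
move=> x0 /derivable1_diffP df.
have [/derivable1_diffP di _] := is_derive1_inv x0.
by apply/derivable1_diffP; exact: differentiable_comp di df.
Qed.

Lemma derive1_comp_inv f x : x != 0 -> derivable f x^-1 1 ->
  derive1 (fun y : K^o => f y^-1) x = - x ^- 2 * derive1 f x^-1.
Proof.
move=> x0 /derivable1_diffP df.
have [/derivable1_diffP di dxi] := is_derive1_inv x0.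
rewrite derive1E'; last exact: differentiable_comp di df.
rewrite (diff_comp di df) derive1E'//=.
rewrite -(@deriveE _ _ _ (fun y : K^o => y^-1 : K^o))// dxi.
by rewrite -[X in 'd  _ _ X = _]mulr1 [LHS]linearZ.
Qed.

Lemma near_inv x (P : K^o -> Prop) : x != 0 ->
  (\forall w \near (x^-1 : K^o), P w) -> \forall y \near x, P y^-1.
Proof. by move=> x0; exact: (@inv_continuous _ _ x0). Qed.

Lemma near_neq0 x : x != 0 -> \forall y \near x, y != 0.
Proof.
by move=> x0; exact: (@cvgr_neq0 K K^o K^o (nbhs x) _ id x cvg_id x0).
Qed.

Lemma near_norm_le f x : {for x, continuous f} ->
  \forall y \near x, `|f y| <= `|f x| + 1.
Proof.
move=> /cvgrPdist_le /(_ 1 ltr01); apply: filterS => y fy.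
rewrite -lerBlDl (le_trans _ fy)// distrC.
by apply: lerB_dist.
Qed.
End Derive1Field.

(** * The energy density in affine charts, and its local boundedness *)

Section Density.
Variable R : realType.
Local Notation C := (R[i]^o).
Implicit Types (f : R[i] -> quintic R) (z : R[i]).

Definition affine_deriv f i z j : R[i] :=
  derive1 (fun x : C => affine i j (f x) : C) z.

(** The chart is prescribed here, whereas the one picked by [energy_density] may jump from point to
    point. *)
Definition chart_density f i z : R :=
  gram_quotient (fun j => affine i j (f z)) (affine_deriv f i z).

Lemma affine_self i (p : quintic R) : in_chart i p -> affine i i p = 1.
Proof. exact: divff. Qed.

(** Outside the chart [k] both sides are 0, by the convention x / 0 = 0. *)
Lemma affine_change i k j (p : quintic R) :
  in_chart i p -> affine k j p = affine i j p / affine i k p.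
Proof. by move=> ip; rewrite /affine invf_div mulrA divfK. Qed.

Lemma affine_neq0 i k (p : quintic R) :
  in_chart i p -> in_chart k p -> affine i k p != 0.
Proof. by move=> ip kp; rewrite mulf_neq0// invr_eq0. Qed.

Definition chart_regular f i z :=
  (\forall w \near (z : C), in_chart i (f w)) /\
  forall j, derivable (fun x : C => affine i j (f x) : C) (z : C) 1.

(** Near [z] the coordinates in chart [k] are those in chart [i] divided by [affine i k], so
    [gram_quotient_scale] applies. *)
Lemma chart_density_change f i k z :
  chart_regular f i z -> in_chart k (f z) ->
  chart_density f k z = chart_density f i z.
Proof.
move=> [fi df] kz; have iz : in_chart i (f z) := nbhs_singleton fi.
have aik := affine_neq0 iz kz.
pose c := (affine i k (f z))^-1.
pose m := - affine i k (f z) ^- 2 * affine_deriv f i z k.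
have c0 : c != 0 by rewrite invr_eq0.
rewrite /chart_density -[RHS](gram_quotient_scale m _ _ c0).
congr gram_quotient.
  by apply/funext => j; rewrite (affine_change k j iz) [LHS]mulrC.
apply/funext => j; rewrite /affine_deriv.
rewrite -(derive1_quotient (df j) (df k) aik).
apply: near_eq_derive1; apply: filterS fi => w iw.
exact: affine_change.
Qed.

Lemma energy_density_chart f i z :
  chart_regular f i z -> energy_density f z = chart_density f i z.
Proof.
move=> fi; pose k := odflt ord0 [pick i | in_chart i (f z)].
rewrite -[LHS]/(chart_density f k z).
apply: chart_density_change fi _; rewrite /k.
(* The default [ord0] never occurs, because every point lies in some chart. *)
case: pickP => //= nf; have [l] := exists_chart (f z).
by rewrite nf.
Qed.

Lemma chart_regular_near f i z : holomorphic_at f z -> in_chart i (f z) ->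
  \forall w \near (z : C), chart_regular f i w.
Proof.
move=> fz iz; have [fi hi] := fz _ iz.
have dj : \forall w \near (z : C), forall j,
    derivable (fun x : C => affine i j (f x) : C) (w : C) 1.
  apply: (@filter_forall _ _ _ (nbhs (z : C)) _) => j.
  by apply: filterS (hi j) => w [].
apply: filterS2 (nbhs_interior fi) dj => w fw dw; split => //.
Qed.

(** In a fixed chart the derivatives are continuous, hence locally bounded, and they dominate the
    density by [gram_quotient_le]. *)
Lemma chart_density_near_bounded f z : holomorphic_at f z ->
  exists i M, \forall w \near (z : C),
    chart_regular f i w /\ chart_density f i w <= M.
Proof.
move=> fz; have [i iz] := exists_chart (f z).
(* Norms take values in [R[i]]; the real part brings the bound back to [R]. *)
exists i, (\sum_j complex.Re ((`|affine_deriv f i z j| + 1) ^+ 2)).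
have [_ hi] := fz _ iz.
have bj : \forall w \near (z : C), forall j,
    `|affine_deriv f i w j| <= `|affine_deriv f i z j| + 1.
  apply: (@filter_forall _ _ _ (nbhs (z : C)) _) => j.
  have [_ cj] := nbhs_singleton (hi j).
  exact: near_norm_le cj.
have := chart_regular_near fz iz.
apply: filterS2 bj => w bw rw; split => //.
have iw := nbhs_singleton rw.1.
apply: le_trans (gram_quotient_le _ (affine_self iw)) _.
apply: ler_sum => j _.
suff : (sqmod (affine_deriv f i w j))%:C <= (`|affine_deriv f i z j| + 1) ^+ 2.
  by rewrite lecE => /andP[].
rewrite sqmodE -sqr_normc lerXn2r// nnegrE// addr_ge0//.
Qed.

Lemma energy_density_near_bounded f z : holomorphic_at f z ->
  exists M, \forall w \near (z : C), energy_density f w <= M.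
Proof.
move=> /chart_density_near_bounded[i [M fM]]; exists M.
by apply: filterS fM => w [rw]; rewrite (energy_density_chart rw).
Qed.

(** The derivative -z^-2 of inversion contributes the factor |z|^-4, the decay at infinity when [h]
    is the map in the chart there. *)
Lemma energy_density_inv f h i z : z != 0 ->
  (forall w, w != 0 -> f w = h w^-1) -> chart_regular h i z^-1 ->
  energy_density f z = sqmod (z ^- 2) * chart_density h i z^-1.
Proof.
move=> z0 fh [hi dh].
have nfh : \forall w \near (z : C), f w = h w^-1.
  by apply: filterS (near_neq0 z0) => w; exact: fh.
have nhi : \forall w \near (z : C), in_chart i (h w^-1).
  exact: (near_inv z0 hi).
have fi : chart_regular f i z.
  split=> [|j]; first by apply: filterS2 nfh nhi => w ->.
  have nf : \forall w \near (z : C), affine i j (h w^-1) = affine i j (f w).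
    by apply: filterS nfh => w ->.
  exact: near_eq_derivable1 nf (derivable_comp_inv z0 (dh j)).
rewrite (energy_density_chart fi) /chart_density.
rewrite -[X in _ = X * _](_ : sqmod (- z ^- 2) = _); last first.
  by rewrite /sqmod; case: (z ^- 2) => a b /=; rewrite !sqrrN.
rewrite -gram_quotient_scaler; congr gram_quotient.
  by apply/funext => j; rewrite fh.
apply/funext => j; rewrite /affine_deriv.
rewrite -(derive1_comp_inv z0 (dh j)).
by apply: near_eq_derive1; apply: filterS nfh => w ->.
Qed.
End Density.

(** * Domination of the density by a multiple of 1 / ((1 + x^2)(1 + y^2)) *)

Section GlobalBound.
Variable R : realType.
Local Notation C := (R[i]^o).
Local Notation a := (fun x : R => (oneDsqr x)^-1).

Lemma near_complex (P : R[i] -> Prop) (x y : R) :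
  (\forall w \near (x +i* y : C), P w) ->
  \forall p \near ((x, y) : R * R), P (p.1 +i* p.2).
Proof.
move=> /nbhs_normP[e e0 eP].
(* Half the radius suffices, because |s + it| <= |s| + |t|. *)
have e2 : 0 < complex.Re e / 2.
  by move: e0; rewrite /= ltcE => /andP[_ e0]; rewrite divr_gt0.
have eE : e = (complex.Re e)%:C.
  by move: e0 => /= /ltW e0; rewrite RRe_real// ger0_real.
exists (ball x (complex.Re e / 2), ball y (complex.Re e / 2)).
  by split; exact: nbhsx_ballx.
move=> [s t] /= []; rewrite /ball /= => xs yt; apply: eP => /=.
have -> : x +i* y - (s +i* t) = (x - s)%:C + 'i%C * (y - t)%:C by simpc.
apply: le_lt_trans (ler_normD _ _) _; rewrite normrM.
have -> : `|'i%C : R[i]| = 1 by rewrite normc_def /= expr0n expr1n add0r sqrtr1.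
have nC (k : R) : `|k%:C| = `|k|%:C.
  by rewrite normc_def /= expr0n addr0 sqrtr_sqr.
by rewrite mul1r !nC -rmorphD /= eE ltcR; lra.
Qed.

(** Local bounds become uniform by compactness of the square, used as a near-covering property with
    the bound tending to +oo. *)
Lemma energy_density_box_bounded (f : R[i] -> quintic R) (r : R) :
  (forall z, holomorphic_at f z) ->
  exists M, forall x y, `|x| <= r -> `|y| <= r ->
    energy_density f (x +i* y) <= M.
Proof.
move=> hf.
have K : compact (`[- r, r]%classic `*` `[- r, r]%classic : set (R * R)).
  by apply: compact_setX; exact: segment_compact.
have [M /= [Mr MP]] : \forall M \near +oo,
    `[- r, r]%classic `*` `[- r, r]%classic `<=`
    (fun p : R * R => energy_density f (p.1 +i* p.2) <= M).
  apply: ((compact_near_coveringP _).1 K) => -[x y] _.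
  have [M fM] := energy_density_near_bounded (hf (x +i* y)).
  exists ([set p : R * R | energy_density f (p.1 +i* p.2) <= M],
          [set N | M <= N]).
    by split; [exact: near_complex fM|apply: nbhs_pinfty_ge; exact: num_real].
  by move=> [p N] /= [pM MN]; exact: le_trans pM MN.
(* The neighbourhood of +oo consists of numbers strictly above [M]. *)
exists (M + 1) => x y xr yr; apply: (MP (M + 1) _ (x, y)).
  by rewrite ltrDl.
by rewrite /= !in_itv /= -!ler_norml.
Qed.

Lemma plane_bound_box (r x y : R) : `|x| <= r -> `|y| <= r ->
  1 <= (1 + r ^+ 2) ^+ 2 * (a x * a y).
Proof.
have le1 t : `|t| <= r -> oneDsqr t <= 1 + r ^+ 2.
  move=> tr; rewrite lerD2l -[t ^+ 2]real_normK ?num_real//.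
  by rewrite lerXn2r ?nnegrE// (le_trans _ tr).
move=> /le1 xr /le1 yr; rewrite -invfM ler_pdivlMr ?mulr_gt0// mul1r expr2.
by apply: ler_pM => //; exact: ltW.
Qed.

(** With s = x^2 + y^2, (1 + x^2)(1 + y^2) <= (1 + s)^2, and 1 <= d^2 s gives 1 + s <= (1 + d^2)
    s. *)
Lemma plane_bound_far (d x y : R) : 0 < d -> 1 <= d ^+ 2 * (x ^+ 2 + y ^+ 2) ->
  (x ^+ 2 + y ^+ 2) ^- 2 <= (1 + d ^+ 2) ^+ 2 * (a x * a y).
Proof.
move=> d0; set s := x ^+ 2 + y ^+ 2 => ds.
have s0 : 0 < s.
  by rewrite -(pmulr_rgt0 _ (exprn_gt0 2 d0)) (lt_le_trans ltr01).
rewrite -invfM ler_pdivlMr ?mulr_gt0// mulrC ler_pdivrMr ?exprn_gt0//.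
apply: (@le_trans _ _ ((1 + s) ^+ 2)).
  by rewrite /oneDsqr /s; have := sqr_ge0 x; have := sqr_ge0 y; nra.
by rewrite -exprMn lerXn2r ?nnegrE//; nra.
Qed.

(** The plane is cut along the square of half-side 1/d, where [d] is the radius of a disc around
    infinity with bounded density: compactness handles the inside, inversion the outside. *)
Lemma sphere_energy_density_le (u : option R[i] -> quintic R) :
  holomorphic_sphere u -> exists2 c : R, 0 <= c & forall x y,
    energy_density (fun z => u (Some z)) (x +i* y) <= c * (a x * a y).
Proof.
move=> [hu huoo].
have [i [M0 /nbhs_normP[e /= e0 eP]]] := chart_density_near_bounded huoo.
pose d := complex.Re e.
have d0 : 0 < d by move: e0; rewrite ltcE => /andP[].
have eE : e = d%:C by rewrite RRe_real// ger0_real// ltW.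
have [M1 M1P] := @energy_density_box_bounded _ d^-1 hu.
(* Truncation at 0 makes both constants nonnegative, so the two bounds can be added. *)
pose M := Num.max M0 0; pose M' := Num.max M1 0.
have M_ge0 : 0 <= M by rewrite le_max lexx orbT.
have M'_ge0 : 0 <= M' by rewrite le_max lexx orbT.
exists (M' * (1 + d^-1 ^+ 2) ^+ 2 + M * (1 + d ^+ 2) ^+ 2).
  by rewrite addr_ge0// mulr_ge0// sqr_ge0.
move=> x y; have a0 : 0 <= a x * a y by rewrite -invfM invr_ge0 mulr_ge0.
rewrite mulrDl -(mulrA M') -(mulrA M).
have [/andP[xd yd]|far] := boolP ((`|x| <= d^-1) && (`|y| <= d^-1)).
  apply: ler_wpDr; first exact: mulr_ge0 M_ge0 (mulr_ge0 (sqr_ge0 _) a0).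
  apply: le_trans (M1P _ _ xd yd) _; apply: (@le_trans _ _ M').
    by rewrite le_max lexx.
  by rewrite ler_peMr// plane_bound_box.
apply: ler_wpDl; first exact: mulr_ge0 M'_ge0 (mulr_ge0 (sqr_ge0 _) a0).
(* Outside the square |z| > 1/d, so 1/z lies in the disc of radius [d]. *)
have ds : 1 < d ^+ 2 * (x ^+ 2 + y ^+ 2).
  have far1 t : d^-1 < `|t| -> 1 < d ^+ 2 * t ^+ 2.
    move=> dt; rewrite -exprMn -[ltRHS]real_normK ?num_real// exprn_egt1//.
    by rewrite normrM (gtr0_norm d0) -ltr_pdivrMl// mulr1.
  rewrite mulrDr; move: far; rewrite negb_and -!ltNge => /orP[]/far1 lt1.
    by apply: lt_le_trans lt1 _; rewrite lerDl mulr_ge0// sqr_ge0.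
  by apply: lt_le_trans lt1 _; rewrite lerDr mulr_ge0// sqr_ge0.
set z := x +i* y.
have s0 : 0 < sqmod z.
  by rewrite -(pmulr_rgt0 _ (exprn_gt0 2 d0)) (lt_trans ltr01).
have z0 : z != 0.
  by apply: contraTneq s0 => ->; rewrite /sqmod /= expr0n addr0 ltxx.
have [|rz cM] := eP z^-1.
  rewrite /ball_ /= sub0r normrN normfV eE.
  have dC0 : 0 < d%:C by rewrite ltcR.
  have nz : 0 < `|z| by rewrite normr_gt0.
  rewrite invf_plt ?posrE// -(@ltr_pXn2r _ 2) ?nnegrE ?invr_ge0 ?ltW//.
  rewrite -add_Re2_Im2 -fmorphV -rmorphXn ltcR exprVn.
  by rewrite -div1r ltr_pdivrMr ?exprn_gt0// mulrC.
rewrite (@energy_density_inv _ _ (fun w => u (inv_chart w)) i)//; last first.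
  by move=> w w0; rewrite /inv_chart invr_eq0 (negPf w0) invrK.
have -> : sqmod (z ^- 2) = (x ^+ 2 + y ^+ 2) ^- 2.
  by rewrite sqmodV expr2 sqmodM -expr2.
apply: (@le_trans _ _ ((x ^+ 2 + y ^+ 2) ^- 2 * M)).
  rewrite ler_wpM2l ?invr_ge0 ?exprn_ge0 ?(ltW s0)//.
  by rewrite (le_trans cM)// le_max lexx.
by rewrite mulrC ler_wpM2l// plane_bound_far// ltW.
Qed.
End GlobalBound.

(** * Integration of the bound and finiteness of the energy *)

(** Argued on simple functions rather than through measurability of [f]: those below the positive
    part of [f] also lie below [h], and the negative part only lowers the integral. *)
Lemma le_integral_ub d (T : measurableType d) (R : realType)
    (mu : {measure set T -> \bar R}) (D : set T) (f h : T -> \bar R) :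
  (forall x, 0 <= h x)%E -> (forall x, D x -> f x <= h x)%E ->
  (\int[mu]_(x in D) f x <= \int[mu]_x h x)%E.
Proof.
move=> h0 fh; rewrite integralE.
have f1 : (\int[mu]_(x in D) f^\+ x <= \int[mu]_x h x)%E.
  rewrite ge0_integralE// ge0_integralTE//; apply: le_ereal_sup => _ [s sf <-].
  exists s => // x; apply: le_trans (sf x) _; rewrite /patch.
  by case: ifPn => // /set_mem Dx; rewrite funeposE ge_max fh// h0.
apply: le_trans f1; rewrite -[leRHS]sube0; apply: leeB => //.
exact: integral_ge0.
Qed.

Section PlaneBound.
Variable R : realType.
Local Notation mu := (@lebesgue_measure R).
Local Notation a := (fun x : R => (oneDsqr x)^-1).

Lemma integral_oneDsqrV : (\int[mu]_x (a x)%:E)%E = (pi : R)%:E.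
Proof.
rewrite ge0_symfun_integralT.
- have -> : [set x : R | 0 <= x] = `[0, +oo[%classic.
    by apply/seteqP; split => x /=; rewrite in_itv /= andbT.
  by rewrite integral0y_oneDsqr -EFinM; congr EFin; field.
- by move=> x; rewrite invr_ge0.
- exact: continuous_oneDsqrV.
- by move=> x; rewrite /= /oneDsqr sqrrN.
Qed.

(** By Tonelli the integral factors, with value c * pi^2. *)
Lemma integral_plane_bound_lty (c : R) : 0 <= c ->
  (\int[(mu \x mu)%E]_p (c * (a p.1 * a p.2))%:E < +oo)%E.
Proof.
move=> c0; have a0 x : 0 <= a x by rewrite invr_ge0.
have ma : measurable_fun setT a.
  by apply: continuous_measurable_fun; exact: continuous_oneDsqrV.
rewrite fubini_tonelli1; last 2 first.
- apply/measurable_EFinP; apply: measurable_funM => //; apply: measurable_funM.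
  + exact: measurableT_comp ma measurable_fst.
  + exact: measurableT_comp ma measurable_snd.
- by move=> p; rewrite lee_fin !mulr_ge0.
rewrite [ltLHS](_ : _ = (\int[mu]_x ((c * pi)%:E * (a x)%:E))%E); last first.
  apply: eq_integral => x _; rewrite /fubini_F /=.
  under eq_integral do rewrite mulrA EFinM.
  rewrite ge0_integralZl_EFin//.
  - by rewrite integral_oneDsqrV -!EFinM mulrAC.
  - exact/measurable_EFinP.
  - by rewrite mulr_ge0.
rewrite ge0_integralZl_EFin//.
- by rewrite integral_oneDsqrV -EFinM ltry.
- exact/measurable_EFinP.
- by rewrite mulr_ge0// pi_ge0.
Qed.
End PlaneBound.

Lemma sphere_energy_lty (R : realType) (u : option R[i] -> quintic R) :
  holomorphic_sphere u -> (energy (fun z => u (Some z)) < +oo)%E.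
Proof.
move=> /sphere_energy_density_le[c c0 uc].
apply: le_lt_trans (integral_plane_bound_lty c0); apply: le_integral_ub.
  by move=> p; rewrite lee_fin !mulr_ge0// invr_ge0.
by move=> p _; rewrite lee_fin.
Qed.

Theorem lemma11p2 (R : realType) (g : quintic R -> quintic R)
    (hg : root5_automorphisms R g)
    (u : option R[i] -> quintic R) (hu : holomorphic_sphere u)
    (hconj : forall z : option R[i],
      u z = conj_quintic (u (omap (@conjc R) z)))
    (hrot : forall z : option R[i],
      u (omap (fun w => gamma R * w) z) = iter 2 g (u z)) :
  exists u0 : R[i] -> quintic R,
    holomorphic_strip g u0 /\ obtained_by_reflection g u0 u.
Proof.
exists (fun z => u (Some z)); split; last first.
  by split=> // k _ z _; exact: sphere_reflected.
split.
(* Even at boundary points [u] itself is the required local extension. *)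
- move=> z _; exists (fun w => u (Some w)); [exact: hu.1|].
  exact: (@filterE _ (nbhs (z : R[i]^o))).
- exact: sphere_energy_lty.
- by move=> r _; exact: sphere_real.
- by move=> r _; exact: sphere_sigma_ray.
Qed.
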